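(* Let $\mathbf X,\mathbf Y$ be (finite) samples from a metric space $(X,d_X)$, let $\epsilon\ge 0$, and let $\mathcal W$ be a cover of the disjoint union $\mathbf X\sqcup\mathbf Y$ such that $d_H(W|_{\mathbf X},W|_{\mathbf Y})\le\epsilon$ for all $W\in\overline{\mathcal W}$. Then $\mathcal R(\mathbf X,\mathcal W;r)$ and $\mathcal R(\mathbf Y,\mathcal W;r)$ are $2\epsilon$-interleaved; that is, for every $q\ge 0$ the persistence vector spaces $H_q(\mathcal R(\mathbf X,\mathcal W;r))$ and $H_q(\mathcal R(\mathbf Y,\mathcal W;r))$, $r\ge 0$, are $(\alpha,\alpha)$-interleaved with $\alpha(r)=r+2\epsilon$.
   Context: $d_H$ is the Hausdorff distance in $(X,d_X)$ (with $d_H(\emptyset,A)=\infty$ for $A\ne\emptyset$). $\overline{\mathcal W}$ is the set of all nonempty intersections $\bigcap_{i\in I}W_i$ of nonempty families $\{W_i\}_{i\in I}\subseteq\mathcal W$. $W|_{\mathbf X}=W\cap\mathbf X$ and $W|_{\mathbf Y}=W\cap\mathbf Y$. For points put $d(x_0,\dots,x_k)=\max_{i,j}d_X(x_i,x_j)$ (with $d(x)=0$). The Vietoris-Rips complex $\mathcal R(\mathbf X;r)$ consists of all simplices $(x_0,\dots,x_k)$ with $x_i\in\mathbf X$ and $d(x_0,\dots,x_k)\le r$. The Vietoris-Rips cover complex $\mathcal R(\mathbf X,\mathcal W;r)$ is the subcomplex of those simplices whose vertices all lie in a common $W\in\mathcal W$; similarly for $\mathbf Y$. As $r$ varies these are filtrations.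 Homology has coefficients in a field. Persistence vector spaces $V,W$ over $\mathbb R_+$ are $(\alpha,\beta)$-interleaved if there are families of linear maps $F^s:V^s\to W^{\alpha(s)}$ and $G^t:W^t\to V^{\beta(t)}$ commuting with the structure maps, such that $G^{\alpha(s)}\circ F^s$ and $F^{\beta(t)}\circ G^t$ are the structure maps $V^s\to V^{\beta\alpha(s)}$ and $W^t\to W^{\alpha\beta(t)}$. *)

(* Defs.v *)
From HB Require Import structures.
From mathcomp Require Import all_boot all_order all_algebra perm.
From mathcomp Require Import generic_quotient finmap.
From mathcomp Require Import classical_sets reals constructive_ereal ereal.
From mathcomp Require Import metric_structure.
From mathcomp Require Import fintype finset.

Set Implicit Arguments.
Unset Strict Implicit.
Unset Printing Implicit Defensive.

Import Order.TTheory GRing.Theory Num.Theory.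
Local Open Scope ring_scope.

(* The quotient of a subspace [U] by a subspace [W], i.e. [U] modulo
   [u - v \in W].  The inclusion of [W] in [U] is not required by the
   construction; it holds where it is used, see [boundaries_sub_cycles]. *)
Section VectQuotient.
Variables (F : fieldType) (vT : vectType F).

Definition vsub_pred (U W : {vspace vT}) (u : subvs_of U) : bool :=
  vsval u \in W.

Lemma vsub_zmod_closed U W : zmod_closed (@vsub_pred U W).
Proof.
split=> [|u v uW vW]; first exact: mem0v.
rewrite unfold_in /vsub_pred linearB; exact: rpredB.
Qed.

HB.instance Definition _ U W :=
  GRing.isZmodClosed.Build (subvs_of U) (@vsub_pred U W)
    (@vsub_zmod_closed U W).

Definition vsub_zmodClosed (U W : {vspace vT}) : zmodClosed (subvs_of U) :=
  GRing.ZmodClosed.clone (subvs_of U) (@vsub_pred U W) _.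

Definition vquot (U W : {vspace vT}) := (Quotient.quot (vsub_zmodClosed U W)).

HB.instance Definition _ U W := GRing.Zmodule.on (vquot U W).

Section Structure.
Variables U W : {vspace vT}.
Implicit Types (u v : subvs_of U) (x y : vquot U W) (a b : F).

Definition vquot_pi u : vquot U W :=
  (\pi_((Quotient.quot (vsub_zmodClosed U W))) u)%qT.

Definition vquot_repr x : subvs_of U :=
  repr (x : (Quotient.quot (vsub_zmodClosed U W))).

Lemma vquot_reprK : cancel vquot_repr vquot_pi.
Proof. by move=> x; rewrite /vquot_pi /vquot_repr reprK. Qed.

Lemma vquot_eq u v :
  (vquot_pi u = vquot_pi v) <-> (vsval u - vsval v \in W).
Proof.
have -> : (vsval u - vsval v \in W) = (vquot_pi u == vquot_pi v).
  by rewrite /vquot_pi -Quotient.idealrBE -linearB.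
exact: (rwP eqP).
Qed.

Lemma vquot_piD : {morph vquot_pi : u v / u + v}.
Proof. by move=> u v; rewrite /vquot_pi !piE. Qed.

Definition vquot_scale a x : vquot U W := vquot_pi (a *: vquot_repr x).

Lemma vquot_piZ a u : vquot_pi (a *: u) = vquot_scale a (vquot_pi u).
Proof.
apply/vquot_eq; rewrite -linearB -scalerBr linearZ; apply: rpredZ; rewrite linearB.
by apply/vquot_eq; rewrite vquot_reprK.
Qed.

Lemma vquot_scalerA a b x :
  vquot_scale a (vquot_scale b x) = vquot_scale (a * b) x.
Proof. by rewrite -[x]vquot_reprK -!vquot_piZ scalerA. Qed.

Lemma vquot_scale1r : left_id 1 vquot_scale.
Proof. by move=> x; rewrite -[x]vquot_reprK -!vquot_piZ scale1r. Qed.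

Lemma vquot_scalerDr : right_distributive vquot_scale +%R.
Proof.
move=> a x y; rewrite -[x]vquot_reprK -[y]vquot_reprK.
by rewrite -vquot_piD -!vquot_piZ -vquot_piD scalerDr.
Qed.

Lemma vquot_scalerDl x : {morph vquot_scale^~ x : a b / a + b}.
Proof.
move=> a b; rewrite -[x]vquot_reprK.
by rewrite -!vquot_piZ -vquot_piD scalerDl.
Qed.

HB.instance Definition _ := GRing.Zmodule_isLmodule.Build F (vquot U W)
  vquot_scalerA vquot_scale1r vquot_scalerDr vquot_scalerDl.

Lemma vquot_pi_is_linear : linear vquot_pi.
Proof. by move=> a u v; rewrite vquot_piD vquot_piZ. Qed.

HB.instance Definition _ :=
  GRing.isLinear.Build F (subvs_of U) (vquot U W) *:%R vquot_pi
    vquot_pi_is_linear.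
End Structure.

(* The linear map U / W -> U' / W' induced by inclusions of U in U' and of W
   in W'. *)
Section Map.
Variables U W U' W' : {vspace vT}.
Hypotheses (sU : (U <= U')%VS) (sW : (W <= W')%VS).

Definition vquot_map_fun (x : vquot U W) : vquot U' W' :=
  vquot_pi W' (vsproj U' (vsval (vquot_repr x))).

Lemma vquot_map_funE u :
  vquot_map_fun (vquot_pi W u) = vquot_pi W' (vsproj U' (vsval u)).
Proof.
apply/vquot_eq; rewrite !vsprojK ?(subvP sU) ?subvsP //; apply: (subvP sW).
by apply/vquot_eq; rewrite vquot_reprK.
Qed.

Lemma vquot_map_is_linear : linear vquot_map_fun.
Proof.
move=> a x y; rewrite -[x]vquot_reprK -[y]vquot_reprK -linearP.
by rewrite !vquot_map_funE -linearP; congr vquot_pi; rewrite !linearP.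
Qed.

HB.instance Definition _ :=
  GRing.isLinear.Build F (vquot U W) (vquot U' W') *:%R vquot_map_fun
    vquot_map_is_linear.

Definition vquot_map : {linear vquot U W -> vquot U' W'} := vquot_map_fun.

Lemma vquot_mapE u :
  vquot_map (vquot_pi W u) = vquot_pi W' (vsproj U' (vsval u)).
Proof. exact: vquot_map_funE. Qed.
End Map.

Lemma vquot_map_id U W (sU : (U <= U)%VS) (sW : (W <= W)%VS) x :
  vquot_map sU sW x = x.
Proof. by rewrite -[x]vquot_reprK vquot_mapE vsvalK. Qed.

Lemma vquot_map_comp U W U' W' U'' W''
    (sU : (U <= U')%VS) (sW : (W <= W')%VS)
    (sU' : (U' <= U'')%VS) (sW' : (W' <= W'')%VS)
    (sU2 : (U <= U'')%VS) (sW2 : (W <= W'')%VS) x :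
  vquot_map sU2 sW2 x = vquot_map sU' sW' (vquot_map sU sW x).
Proof.
rewrite -[x]vquot_reprK !vquot_mapE vsprojK //.
by rewrite (subvP sU) ?subvsP.
Qed.
End VectQuotient.

(* Finite abstract simplicial complexes on (a subset of) the vertex type V. *)
Record simplicial_complex (V : finType) := SimplicialComplex {
  simplices :> {set {set V}};
  simplex_neq0 : set0 \notin simplices;
  simplex_face : forall s t : {set V},
    s \in simplices -> t \subset s -> t != set0 -> t \in simplices
}.

(* Simplicial homology over F, by oriented chains: a q-chain of K is a function
   c on ordered q-simplices (x_0, ..., x_q) of K, x_i pairwise distinct, with
   c (x_s(0), ..., x_s(q)) = sgn(s) c (x_0, ..., x_q) for every permutation s;
   the value c (x_0, ..., x_q) is the coefficient of the oriented simplex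
   [x_0, ..., x_q]. *)
Section Homology.
Variables (F : fieldType) (V : finType).

Definition tuple_fun q := {ffun q.+1.-tuple V -> F^o}.

Definition permute q (s : 'S_q.+1) (x : q.+1.-tuple V) : q.+1.-tuple V :=
  [tuple tnth x (s i) | i < q.+1].

Definition permute_fun q (s : 'S_q.+1) (c : tuple_fun q) : tuple_fun q :=
  [ffun x => c (permute s x)].

Lemma permute_fun_is_linear q s : linear (@permute_fun q s).
Proof. by move=> a c d; apply/ffunP=> x; rewrite !ffunE. Qed.

HB.instance Definition _ q s :=
  GRing.isLinear.Build F (tuple_fun q) (tuple_fun q) *:%R (@permute_fun q s)
    (@permute_fun_is_linear q s).

Definition coef_at q (x : q.+1.-tuple V) (c : tuple_fun q) : F^o := c x.

Lemma coef_at_is_linear q x : linear (@coef_at q x).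
Proof. by move=> a c d; rewrite /coef_at !ffunE. Qed.

HB.instance Definition _ q x :=
  GRing.isLinear.Build F (tuple_fun q) F^o *:%R (@coef_at q x)
    (@coef_at_is_linear q x).

Definition is_simplex (K : simplicial_complex V) q (x : q.+1.-tuple V) :=
  uniq x && ([set v in x] \in (K : {set {set V}})).

Definition chains (K : simplicial_complex V) q : {vspace tuple_fun q} :=
  ((\bigcap_(x | ~~ is_simplex K x) lker (linfun (coef_at x)))
   :&: (\bigcap_(s : 'S_q.+1)
          lker (linfun (@permute_fun q s) - (-1) ^+ s *: \1%VF)))%VS.

Lemma chainsP (K : simplicial_complex V) q (c : tuple_fun q) :
  reflect ((forall x, ~~ is_simplex K x -> c x = 0) /\
           (forall (s : 'S_q.+1) x, c (permute s x) = (-1) ^+ s * c x))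
          (c \in chains K q).
Proof.
rewrite memv_cap; apply: (iffP andP) => -[h1 h2]; split.
- move=> x nx; move: h1; rewrite memvE => /subv_bigcapP/(_ x nx).
  by rewrite -memvE memv_ker lfunE => /eqP.
- move=> s x; move: h2; rewrite memvE => /subv_bigcapP/(_ s isT).
  rewrite -memvE memv_ker add_lfunE opp_lfunE scale_lfunE id_lfunE lfunE /=.
  by rewrite subr_eq0 => /eqP/ffunP/(_ x); rewrite !ffunE.
- rewrite memvE; apply/subv_bigcapP=> x nx.
  by rewrite -memvE memv_ker lfunE /= /coef_at h1.
- rewrite memvE; apply/subv_bigcapP=> s _.
  rewrite -memvE memv_ker add_lfunE opp_lfunE scale_lfunE id_lfunE lfunE /=.
  by rewrite subr_eq0; apply/eqP/ffunP=> x; rewrite !ffunE h2.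
Qed.

(* [x_0, ..., x_q+1] is sent to the sum of the (-1)^i [x_0, ..^x_i.., x_q+1]:
   the coefficient of [y] in the image of c is the sum over the vertices v of
   the coefficient of [v, y] in c. *)
Definition boundary_fun q (c : tuple_fun q.+1) : tuple_fun q :=
  [ffun y : q.+1.-tuple V => \sum_(v : V) c [tuple of v :: y]].

Lemma boundary_fun_is_linear q : linear (@boundary_fun q).
Proof.
move=> a c d; apply/ffunP=> y; rewrite !ffunE scaler_sumr -big_split /=.
by apply: eq_bigr => v _; rewrite !ffunE.
Qed.

HB.instance Definition _ q :=
  GRing.isLinear.Build F (tuple_fun q.+1) (tuple_fun q) *:%R (@boundary_fun q)
    (@boundary_fun_is_linear q).

Definition boundary q : 'Hom(tuple_fun q.+1, tuple_fun q) :=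
  linfun (@boundary_fun q).

Definition cycles (K : simplicial_complex V) q : {vspace tuple_fun q} :=
  match q with
  | 0 => chains K 0
  | q'.+1 => (chains K q'.+1 :&: lker (boundary q'))%VS
  end.

Definition boundaries (K : simplicial_complex V) q : {vspace tuple_fun q} :=
  (boundary q @: chains K q.+1)%VS.

Definition homology (K : simplicial_complex V) q : lmodType F :=
  vquot (cycles K q) (boundaries K q).

Lemma permute_cons q (s : 'S_q.+1) v (y : q.+1.-tuple V) :
  permute (lift_perm ord0 ord0 s) [tuple of v :: y] =
  [tuple of v :: permute s y].
Proof.
apply: eq_from_tnth => i; rewrite tnth_mktuple.
case: (unliftP ord0 i) => [j|] ->.
  by rewrite lift_perm_lift !tnthS tnth_mktuple.
by rewrite lift_perm_id.
Qed.

Lemma permute_swap q v w (y : q.-tuple V) :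
  permute (tperm ord0 (lift ord0 ord0)) [tuple of v :: w :: y] =
  [tuple of w :: v :: y].
Proof.
apply: eq_from_tnth => i; rewrite tnth_mktuple.
case: tpermP => [->|->|] //.
case: (unliftP ord0 i) => [j|] -> // _.
case: (unliftP ord0 j) => [k|] -> // _.
by rewrite !tnthS.
Qed.

Lemma boundary_chains (K : simplicial_complex V) q (c : tuple_fun q.+1) :
  c \in chains K q.+1 -> boundary q c \in chains K q.
Proof.
move=> /chainsP[h1 h2]; rewrite lfunE /=; apply/chainsP; split=> [y ny|s y].
  rewrite ffunE big1 // => v _; apply: h1; apply: contra ny.
  case/andP=> /= /andP[_ uy] vy; rewrite /is_simplex uy /=.
  apply: simplex_face vy _ _; first by apply/subsetP=> w; rewrite !inE orbC => ->.
  by apply/set0Pn; exists (thead y); rewrite inE mem_tnth.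
rewrite !ffunE mulr_sumr; apply: eq_bigr => v _.
by rewrite -permute_cons h2 odd_lift_perm.
Qed.

Lemma boundary_boundary (K : simplicial_complex V) q (c : tuple_fun q.+2) :
  c \in chains K q.+2 -> boundary q (boundary q.+1 c) = 0.
Proof.
move=> /chainsP[h1 h2]; rewrite !lfunE /=; apply/ffunP=> y; rewrite !ffunE.
pose G (v w : V) : F := c [tuple of w :: [tuple of v :: y]].
have -> : \sum_v boundary_fun c [tuple of v :: y] = \sum_v \sum_w G v w.
  by apply: eq_bigr => v _; rewrite ffunE.
have Gvv v : G v v = 0 by apply: h1; rewrite /is_simplex /= inE eqxx.
have GN v w : G v w = - G w v.
  rewrite /G.
  have -> : [tuple of w :: [tuple of v :: y]] =
            [tuple of w :: v :: y] :> q.+3.-tuple V.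
    exact: val_inj.
  rewrite -permute_swap h2 odd_tperm /= expr1 mulN1r.
  by congr (- c _); apply: val_inj.
rewrite pair_big /= (bigID (fun p => enum_rank p.1 < enum_rank p.2)%N) /=.
rewrite [X in _ + X](bigID (fun p => p.1 == p.2)) /= [X in _ + (X + _)]big1; last first.
  by case=> v w /= /andP[_ /eqP->].
rewrite add0r [X in _ + X](reindex_inj (can_inj (@swap_pairK V V))) /=.
rewrite [X in _ + X](eq_bigl (fun p => enum_rank p.1 < enum_rank p.2)%N); last first.
  case=> v w /=; rewrite -leqNgt ltn_neqAle andbC eq_sym; congr (~~ _ && _).
  by rewrite (inj_eq val_inj) (inj_eq enum_rank_inj).
by rewrite -big_split big1 //= => -[v w] _ /=; rewrite GN addNr.
Qed.

Lemma boundaries_sub_cycles (K : simplicial_complex V) q :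
  (boundaries K q <= cycles K q)%VS.
Proof.
apply/subvP=> _ /memv_imgP[c cK ->].
case: q c cK => [|q] c cK; first exact: boundary_chains.
by rewrite /= memv_cap boundary_chains //= memv_ker (boundary_boundary cK).
Qed.

Section Inclusion.
Variables K L : simplicial_complex V.
Hypothesis sKL : K \subset L.

Lemma chains_sub q : (chains K q <= chains L q)%VS.
Proof.
apply/subvP=> c /chainsP[h1 h2]; apply/chainsP; split=> // x nx.
apply: h1; apply: contra nx => /andP[ux xK].
by rewrite /is_simplex ux (subsetP sKL).
Qed.

Lemma cycles_sub q : (cycles K q <= cycles L q)%VS.
Proof.
by case: q => [|q] /=; [exact: chains_sub|apply: capvS => //; exact: chains_sub].
Qed.

Lemma boundaries_sub q : (boundaries K q <= boundaries L q)%VS.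
Proof. by apply: limgS; exact: chains_sub. Qed.

Definition homology_incl q : {linear homology K q -> homology L q} :=
  vquot_map (cycles_sub q) (boundaries_sub q).
End Inclusion.
End Homology.

(* A family of vector spaces over F indexed by the reals r >= 0, possibly
   infinite-dimensional. *)
Record persistence_vect (F : fieldType) (R : realType) := PersistenceVect {
  pv_space :> {nonneg R} -> lmodType F;
  pv_map : forall s t : {nonneg R}, s <= t ->
    {linear pv_space s -> pv_space t};
  pv_map_id : forall (s : {nonneg R}) (le_ss : s <= s) x, pv_map le_ss x = x;
  pv_map_comp : forall (s t u : {nonneg R}) (le_st : s <= t) (le_tu : t <= u)
    (le_su : s <= u) x, pv_map le_su x = pv_map le_tu (pv_map le_st x)
}.
Arguments pv_map {F R} p {s t}.

(* The conditions on alpha and beta are those under which the structure maps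
   occurring in the definition exist. *)
Definition interleaved (F : fieldType) (R : realType)
    (V W : persistence_vect F R) (alpha beta : {nonneg R} -> {nonneg R}) :=
  exists (alpha_mono : {homo alpha : s t / s <= t})
         (beta_mono : {homo beta : s t / s <= t})
         (le_ba : forall s, s <= beta (alpha s))
         (le_ab : forall t, t <= alpha (beta t))
         (f : forall s, {linear V s -> W (alpha s)})
         (g : forall t, {linear W t -> V (beta t)}),
  [/\ forall s t (le_st : s <= t) x,
        f t (pv_map V le_st x) = pv_map W (alpha_mono s t le_st) (f s x),
      forall s t (le_st : s <= t) y,
        g t (pv_map W le_st y) = pv_map V (beta_mono s t le_st) (g s y),
      forall s x, g (alpha s) (f s x) = pv_map V (le_ba s) x
    & forall t y, f (beta t) (g t y) = pv_map W (le_ab t) y].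

Record filtration (R : realType) (V : finType) := Filtration {
  filt_complex :> {nonneg R} -> simplicial_complex V;
  filt_sub : forall s t : {nonneg R}, s <= t ->
    filt_complex s \subset filt_complex t
}.

Section PersistentHomology.
Variables (F : fieldType) (R : realType) (V : finType) (K : filtration R V).
Variable q : nat.

Definition ph_map (s t : {nonneg R}) (le_st : s <= t) :
    {linear homology F (K s) q -> homology F (K t) q} :=
  homology_incl F (filt_sub K le_st) q.

Lemma ph_map_id (s : {nonneg R}) (le_ss : s <= s) x : ph_map le_ss x = x.
Proof. exact: vquot_map_id. Qed.

Lemma ph_map_comp (s t u : {nonneg R}) (le_st : s <= t) (le_tu : t <= u)
  (le_su : s <= u) x : ph_map le_su x = ph_map le_tu (ph_map le_st x).
Proof. exact: vquot_map_comp. Qed.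

Definition persistent_homology : persistence_vect F R :=
  PersistenceVect ph_map_id ph_map_comp.
End PersistentHomology.

Section Hausdorff.
Local Open Scope classical_set_scope.
Local Open Scope ereal_scope.
Variables (R : realType) (T : metricType R).

(* The outer [maxe 0] only matters for A = B = set0, where the two suprema are
   -oo.  If exactly one of A and B is empty the value is +oo. *)
Definition hausdorff_dist (A B : set T) : \bar R :=
  maxe 0
    (maxe (ereal_sup [set ereal_inf [set (mdist a b)%:E | b in B] | a in A])
          (ereal_sup [set ereal_inf [set (mdist a b)%:E | a in A] | b in B])).
End Hausdorff.

(* Nonempty intersections of nonempty subfamilies. *)
Definition nonempty_intersections (P : finType) (W : {set {set P}}) :
    {set {set P}} :=
  [set A : {set P} | A != set0 &
    [exists I : {set {set P}},
      [&& I != set0, I \subset W & A == \bigcap_(B in I) B]]].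

(* The disjoint union of P and Q is the sum type [P + Q]. *)
Definition restrict_l (P Q : finType) (W : {set P + Q}) : {set P} :=
  [set x | inl x \in W].
Definition restrict_r (P Q : finType) (W : {set P + Q}) : {set Q} :=
  [set y | inr y \in W].

Section VietorisRips.
Variables (R : realType) (T : metricType R) (S : {fset T}).

Definition points (A : {set S}) : set T :=
  [set fsval x | x in [set` A]]%classic.

Definition diam (s : {set S}) : R :=
  \big[Num.max/0]_(x in s) \big[Num.max/0]_(y in s)
    mdist (fsval x) (fsval y).

Lemma diam_subset (s t : {set S}) : t \subset s -> diam t <= diam s.
Proof.
move=> ts.
apply: (le_trans _ (sub_bigmax _ _ (subsetP ts))).
apply: le_bigmax2 => x _; exact: (sub_bigmax _ _ (subsetP ts)).
Qed.

Definition rips_simplices (r : R) : {set {set S}} :=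
  [set s : {set S} | (s != set0) && (diam s <= r)].

Lemma rips_neq0 r : set0 \notin rips_simplices r.
Proof. by rewrite inE eqxx. Qed.

Lemma rips_face r (s t : {set S}) :
  s \in rips_simplices r -> t \subset s -> t != set0 -> t \in rips_simplices r.
Proof.
rewrite !inE => /andP[_ dr] ts -> /=; exact: le_trans (diam_subset ts) dr.
Qed.

Definition rips (r : R) : simplicial_complex S :=
  SimplicialComplex (@rips_neq0 r) (@rips_face r).

(* [C] is the family of the restrictions to the sample S of the members of the
   cover. *)
Definition rips_cover_simplices (C : {set {set S}}) (r : R) : {set {set S}} :=
  [set s in (rips r : {set {set S}}) | [exists W in C, s \subset W]].

Lemma rips_cover_neq0 C r : set0 \notin rips_cover_simplices C r.
Proof. by rewrite inE (negPf (rips_neq0 r)). Qed.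

Lemma rips_cover_face C r (s t : {set S}) :
  s \in rips_cover_simplices C r -> t \subset s -> t != set0 ->
  t \in rips_cover_simplices C r.
Proof.
rewrite !inE => /andP[sr /exists_inP[W WC sW]] ts t0.
have := @rips_face r s t; rewrite !inE => -> //=.
by apply/exists_inP; exists W => //; apply: subset_trans sW.
Qed.

Definition rips_cover (C : {set {set S}}) (r : R) : simplicial_complex S :=
  SimplicialComplex (@rips_cover_neq0 C r) (@rips_cover_face C r).

Lemma rips_cover_mono C (s t : {nonneg R}) : s <= t ->
  rips_cover C s%:num \subset rips_cover C t%:num.
Proof.
move=> st; apply/subsetP=> A; rewrite !inE => /andP[/andP[-> dA] ->].
by rewrite (le_trans dA).
Qed.

Definition rips_cover_filtration (C : {set {set S}}) : filtration R S :=
  @Filtration R S (fun r => rips_cover C r%:num) (@rips_cover_mono C).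
End VietorisRips.

(* Main.v *)
(* The intersection of all members of the cover containing a point x of X is
   within Hausdorff distance eps of its counterpart in Y, so it contains a point
   phi x of Y at distance at most eps from x; then phi x lies in every member of
   the cover containing x.  Hence phi, and likewise psi : Y -> X, are simplicial
   maps between the cover complexes with parameter shift 2 eps, and psi \o phi is
   contiguous to the identity after a shift of 4 eps.

   Contiguous maps f and g induce the same map in homology: changing f into g
   one vertex at a time, we may assume that they differ only at a vertex v.  For
   a cycle c, the chain g_# c - f_# c has zero (augmented) boundary, so it is the
   boundary of its cone with apex f v, and that cone is a chain of the target. *)
Require Import Defs.
From HB Require Import structures.
From mathcomp Require Import all_boot all_order all_algebra perm finmap.
From mathcomp Require Import classical_sets reals constructive_ereal ereal.
From mathcomp Require Import metric_structure lra.
From mathcomp Require Import fintype finset.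

Import Order.TTheory GRing.Theory Num.Theory.
Local Open Scope ring_scope.

Set Implicit Arguments.
Unset Strict Implicit.
Unset Printing Implicit Defensive.

(** * Signed sums, tuples and permutations *)

Lemma sum_sign_involution (M : zmodType) (I : finType) (P : pred I)
    (t : I -> I) (c : I -> M) :
  involutive t -> (forall i, P (t i) = P i) -> (forall i, c (t i) = - c i) ->
  (forall i, t i = i -> c i = 0) ->
  \sum_(i | P i) c i = 0.
Proof.
move=> tK Pt ct c0.
(* [lt] selects one index from each two-element orbit of [t]. Fixed points need a hypothesis of
   their own: where 2 vanishes, [c i = - c i] does not give [c i = 0]. *)
pose lt i := (enum_rank i < enum_rank (t i))%N.
rewrite (bigID (fun i => t i == i)) /= big1 ?add0r => [|i /andP[_ /eqP]]; last exact: c0.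
rewrite (bigID lt) /= [X in _ + X](reindex_inj (can_inj tK)) /=.
rewrite [X in _ + X](eq_bigl (fun i => P i && (t i != i) && lt i)); last first.
  move=> i; rewrite /lt Pt tK -leqNgt ltn_neqAle (inj_eq val_inj).
  by rewrite (inj_eq enum_rank_inj) eq_sym; case: (P i); case: (t i == i).
by rewrite -big_split big1 //= => i _; rewrite ct addrN.
Qed.

Lemma set_map_tuple (V V' : finType) n (f : V -> V') (x : n.-tuple V) :
  [set v in map_tuple f x] = f @: [set v in x].
Proof.
apply/setP=> w; rewrite inE; apply/mapP/imsetP => -[v vx ->]; exists v => //.
  by rewrite inE.
by rewrite inE in vx.
Qed.

Lemma permuteK (V : finType) q (s : 'S_q.+1) : cancel (@permute V q s) (permute s^-1).
Proof.
by move=> x; apply: eq_from_tnth => i; rewrite !tnth_mktuple permKV.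
Qed.

Lemma permuteKV (V : finType) q (s : 'S_q.+1) : cancel (@permute V q s^-1) (permute s).
Proof. by move=> x; apply: eq_from_tnth => i; rewrite !tnth_mktuple permK. Qed.

Lemma not_uniq_tnth (V : eqType) n (x : n.-tuple V) :
  ~~ uniq x -> exists i j, [/\ i != j & tnth x i = tnth x j].
Proof.
move=> /tuple_uniqP/injectiveP/injectivePn[i [j ij eij]]; by exists i, j.
Qed.

(** * Chain maps induced by vertex maps *)

Section Pushforward.
Variables (F : fieldType) (V V' : finType) (f : V -> V').

(** The convention that a simplex collapsed by [f] goes to zero is not built in; for chains it
    follows from alternation, see [push_not_uniq]. *)
Definition push q (c : tuple_fun F V q) : tuple_fun F V' q :=
  [ffun y => \sum_(x | map_tuple f x == y) c x].

Lemma push_is_linear q : linear (@push q).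
Proof.
move=> a c d; apply/ffunP=> y; rewrite !ffunE scaler_sumr -big_split /=.
by apply: eq_bigr => v _; rewrite !ffunE.
Qed.

HB.instance Definition _ q :=
  GRing.isLinear.Build F (tuple_fun F V q) (tuple_fun F V' q) *:%R (@push q)
    (@push_is_linear q).

Lemma map_permute q (s : 'S_q.+1) (x : q.+1.-tuple V) :
  map_tuple f (permute s x) = permute s (map_tuple f x).
Proof. by apply: eq_from_tnth => i; rewrite !(tnth_map, tnth_mktuple). Qed.

Lemma push_permute q (s : 'S_q.+1) (c : tuple_fun F V q) (y : q.+1.-tuple V') :
  (forall x, c (permute s x) = (-1) ^+ s * c x) ->
  push c (permute s y) = (-1) ^+ s * push c y.
Proof.
move=> cs; rewrite !ffunE (reindex_inj (can_inj (permuteK s))) mulr_sumr.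
apply: eq_big => [x|x _]; last exact: cs.
by rewrite map_permute (can_eq (permuteK s)).
Qed.

(** Exchanging two positions where [y] has equal entries preserves the fibre over [y] and reverses
    the sign of [c]. A tuple fixed by the exchange repeats a vertex, so [c] vanishes on it. *)
Lemma push_not_uniq (K : simplicial_complex V) q (c : tuple_fun F V q)
    (y : q.+1.-tuple V') :
  c \in chains F K q -> ~~ uniq y -> push c y = 0.
Proof.
move=> /chainsP[c0 cs] /not_uniq_tnth[i [j [ij eij]]].
have tK x : permute (tperm i j) (permute (tperm i j) x) = x :> q.+1.-tuple V.
  by have := permuteKV (tperm i j) x; rewrite tpermV.
rewrite ffunE; apply: (sum_sign_involution (t := permute (tperm i j))) => // x.
- rewrite map_permute -[X in _ == X](_ : permute (tperm i j) y = y).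
    by rewrite (can_eq (permuteK _)).
  apply: eq_from_tnth => k; rewrite tnth_mktuple.
  by case: tpermP => [->|->|].
- by rewrite cs odd_tperm ij expr1 mulN1r.
- move=> tx; apply: c0; rewrite negb_and; apply/orP; left.
  apply/negP=> /tuple_uniqP ix; move/negP: ij; apply; apply/eqP/ix.
  by rewrite -[in LHS]tx tnth_mktuple tpermL.
Qed.

(** Both sides sum [c] over the tuples whose tail maps to [w], grouped by the image of the head or
    by the tail. Allowing [w] to be empty makes this cover the augmentation as well as the
    boundary. *)
Lemma sum_push q (c : tuple_fun F V q) (w : q.-tuple V') :
  \sum_v push c [tuple of v :: w] =
  \sum_(x : q.-tuple V | map_tuple f x == w) \sum_u c [tuple of u :: x].
Proof.
under eq_bigr do rewrite ffunE.
pose P (x : q.+1.-tuple V) := map_tuple f [tuple of behead x] == w.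
transitivity (\sum_(x | P x) c x).
  rewrite [RHS](partition_big (fun x => f (thead x)) xpredT) //=.
  apply: eq_bigr => v _; apply: eq_bigl => x.
  case/tupleP: x => u x; rewrite /P theadE.
  rewrite -(inj_eq val_inj) /= eqseq_cons andbC.
  by rewrite -(inj_eq val_inj) /=.
rewrite pair_big_dep /=.
rewrite (reindex (fun p : q.-tuple V * V => [tuple of p.2 :: p.1])) /=.
  by apply: eq_bigl => -[x u] /=; rewrite andbT -(inj_eq val_inj).
exists (fun x : q.+1.-tuple V => ([tuple of behead x], thead x)) => [[x u]|x] _ /=.
  by congr (_, _); apply: val_inj.
by rewrite [RHS]tuple_eta.
Qed.

Lemma push_boundary q (c : tuple_fun F V q.+1) :
  boundary F V' q (push c) = push (boundary F V q c).
Proof.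
rewrite !lfunE; apply/ffunP=> y; rewrite /= !ffunE sum_push.
by apply: eq_bigr => x _; rewrite ffunE.
Qed.

End Pushforward.

(** * Deleting an entry, and cones *)

Lemma lift_permP n (s : 'S_n.+1) (i : 'I_n.+1) :
  exists s' : 'S_n, s = lift_perm i (s i) s'.
Proof.
(* [s] maps the positions other than [i] bijectively to those other than [s i]; [h] is this
   bijection after renumbering. *)
have /fin_all_exists[h hE] j : exists k, s (lift i j) = lift (s i) k.
  have : s i != s (lift i j) by rewrite (inj_eq perm_inj) neq_lift.
  by move=> /unlift_some[k kE _]; exists k.
have hI : injective h.
  by move=> j k jk; apply/(@lift_inj _ i)/(@perm_inj _ s); rewrite !hE jk.
exists (perm hI); apply/permP=> k.
case: (unliftP i k) => [j|] ->; last by rewrite lift_perm_id.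
by rewrite lift_perm_lift permE hE.
Qed.

Definition omit (T : Type) n (i : 'I_n.+1) (y : n.+1.-tuple T) : n.-tuple T :=
  [tuple tnth y (lift i j) | j < n].

Lemma omit0_cons T n v (y : n.-tuple T) : omit ord0 [tuple of v :: y] = y.
Proof. by apply: eq_from_tnth => j; rewrite tnth_mktuple tnthS. Qed.

Lemma omitS_cons T n v (y : n.+1.-tuple T) i :
  omit (lift ord0 i) [tuple of v :: y] = [tuple of v :: omit i y].
Proof.
apply: eq_from_tnth => j; rewrite tnth_mktuple.
case: (unliftP ord0 j) => [k|] -> //.
rewrite tnthS tnth_mktuple -[RHS](tnthS v).
by congr (tnth _ _); apply: val_inj; rewrite /= /bump !add1n ltnS addnS.
Qed.

Lemma set_omit (V : finType) n (i : 'I_n.+1) (y : n.+1.-tuple V) :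
  [set v in y] = tnth y i |: [set v in omit i y].
Proof.
apply/setP=> w; rewrite !inE; apply/idP/idP => [/tnthP[k ->]|].
  case: (unliftP i k) => [j|] ->; last by rewrite eqxx.
  by apply/orP; right; apply/tnthP; exists j; rewrite tnth_mktuple.
case/orP => [/eqP->|/tnthP[j ->]]; first exact: mem_tnth.
by rewrite tnth_mktuple mem_tnth.
Qed.

Lemma omit_repeated (T : eqType) n (u : T) (z : n.-tuple T) (i : 'I_n) :
  ~~ uniq (omit (lift ord0 (lift ord0 i)) [tuple of u :: [tuple of u :: z]]).
Proof.
case: n z i => [|n] z i; first by case: i.
by rewrite !omitS_cons /= inE eqxx.
Qed.

Section Cone.
Variables (F : fieldType) (V : finType) (a : V).

(* [x_0, ..., x_q] is sent to [a, x_0, ..., x_q]. *)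
Definition cone q (c : tuple_fun F V q) : tuple_fun F V q.+1 :=
  [ffun y => \sum_i (tnth y i == a)%:R * ((-1) ^+ i * c (omit i y))].

(** This is the cone formula: the boundary of the cone is [c] minus the cone of the boundary of [c].
    The new vertex gives [c y] when it equals [a]; the later positions carry one more sign. For
    [q = 0] the inner sum is the augmentation. *)
Lemma sum_cone q (c : tuple_fun F V q) (y : q.+1.-tuple V) :
  \sum_v cone c [tuple of v :: y] =
  c y - \sum_i (tnth y i == a)%:R *
          ((-1) ^+ i * \sum_v c [tuple of v :: omit i y]).
Proof.
transitivity (\sum_v ((v == a)%:R * c y -
  \sum_i (tnth y i == a)%:R * ((-1) ^+ i * c [tuple of v :: omit i y]))).
  apply: eq_bigr => v _; rewrite ffunE big_ord_recl /= mul1r omit0_cons.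
  congr (_ + _); rewrite -sumrN; apply: eq_bigr => i _.
  by rewrite omitS_cons tnthS exprS !mulN1r mulNr mulrN.
rewrite sumrB; congr (_ - _).
  rewrite (bigD1 a) //= eqxx mul1r big1 ?addr0 // => v /negPf->.
  by rewrite mul0r.
rewrite exchange_big; apply: eq_bigr => i _.
by rewrite -!mulr_sumr.
Qed.

(** The hypothesis is that the augmented boundary vanishes. For [q = 0] it says that the
    coefficients sum to zero, which membership in [cycles] does not give. *)
Lemma boundary_cone q (c : tuple_fun F V q) :
  (forall w : q.-tuple V, \sum_v c [tuple of v :: w] = 0) ->
  boundary F V q (cone c) = c.
Proof.
move=> c0; rewrite lfunE; apply/ffunP=> y; rewrite ffunE sum_cone.
by rewrite big1 ?subr0 // => i _; rewrite c0 !mulr0.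
Qed.

(** Deleting position [i] after permuting by [s] amounts to deleting position [s i] and then
    permuting by the induced [s']; the signs of [s] and [s'] differ by the parity of [i + s i]. *)
Lemma cone_permute q (c : tuple_fun F V q) s y :
  (forall (s : 'S_q.+1) x, c (permute s x) = (-1) ^+ s * c x) ->
  cone c (permute s y) = (-1) ^+ s * cone c y.
Proof.
move=> cs; rewrite !ffunE [in RHS](reindex_inj (@perm_inj _ s)) mulr_sumr.
apply: eq_bigr => i _ /=; rewrite tnth_mktuple [RHS]mulrCA; congr (_ * _).
have [s' sE] := lift_permP s i.
rewrite (_ : omit i _ = permute s' (omit (s i) y)); last first.
  apply: eq_from_tnth => j; rewrite !tnth_mktuple.
  by rewrite [in LHS]sE lift_perm_lift.
rewrite cs !mulrA; congr (_ * _); rewrite [X in (-1) ^+ odd_perm X * _]sE odd_lift_perm.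
rewrite -(signr_odd _ i) -(signr_odd _ (s i)).
by case: (odd i); case: (odd (s i)); case: (odd_perm s') => //=;
  rewrite ?(expr0, expr1, mul1r, mulr1, mulN1r, opprK).
Qed.

(** Alternation alone would only give [cone c y = - cone c y], which is void in characteristic 2.
    Instead the equal entries are moved to the front, where the terms deleting one or the other
    cancel. *)
Lemma cone_not_uniq q (c : tuple_fun F V q) (y : q.+2.-tuple V) :
  (forall (s : 'S_q.+1) x, c (permute s x) = (-1) ^+ s * c x) ->
  (forall x : q.+1.-tuple V, ~~ uniq x -> c x = 0) ->
  ~~ uniq y -> cone c y = 0.
Proof.
move=> cs c0 /not_uniq_tnth[k [l [kl ekl]]].
have {kl ekl k l} [s es] : exists s : 'S_q.+2,
    tnth y (s ord0) = tnth y (s (lift ord0 ord0)).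
  have [l' lE _] := unlift_some kl.
  (* This permutation sends position 0 to [k] and position 1 to [lift k l'], that is [l]. *)
  exists (lift_perm ord0 k (tperm ord0 l')).
  by rewrite lift_perm_id lift_perm_lift tpermL -lE.
apply: (@mulrI _ ((-1) ^+ s)); first exact: unitrX (unitrN1 _).
rewrite mulr0 -cone_permute //.
have : tnth (permute s y) ord0 = tnth (permute s y) (lift ord0 ord0).
  by rewrite !tnth_mktuple.
case/tupleP: (permute s y) => u x; case/tupleP: x => w z.
rewrite tnthS !tnth0 => <- {w}.
rewrite ffunE !big_ord_recl big1 => [|i _].
  rewrite omitS_cons !omit0_cons tnthS !tnth0 addr0.
  by rewrite expr1 mulN1r mulrN expr0 mul1r addrN.
(* Deleting any later position leaves both copies of [u]. *)
by rewrite c0 ?mulr0 // omit_repeated.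
Qed.

(** A nonzero term at [y] comes from an entry equal to [a] whose deletion leaves a simplex in the
    support of [c]; adding [a] back recovers the vertex set of [y]. Only that support has to be
    joinable to [a] inside [L]. *)
Lemma cone_chains (L : simplicial_complex V) q (c : tuple_fun F V q) :
  c \in chains F L q ->
  (forall x : q.+1.-tuple V, is_simplex L x -> c x != 0 ->
     a |: [set v in x] \in (L : {set {set V}})) ->
  cone c \in chains F L q.+1.
Proof.
move=> /chainsP[c0 cs] ca; apply/chainsP; split=> [y|s y]; last exact: cone_permute.
have cu (x : q.+1.-tuple V) : ~~ uniq x -> c x = 0.
  by move=> ux; apply: c0; rewrite negb_and ux.
rewrite negb_and; have [uy /= nL|uy _] := boolP (uniq y); last exact: cone_not_uniq.
rewrite ffunE big1 // => i _; have [yi|] := eqVneq (tnth y i) a; last by rewrite mul0r.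
suff -> : c (omit i y) = 0 by rewrite !mulr0.
apply/eqP; apply: contraNT nL => ci; rewrite (set_omit i) yi; apply: ca => //.
by apply: contraNT ci => /c0 ->.
Qed.
End Cone.

(** * Simplicial and contiguous maps *)

Lemma eq_push (F : fieldType) (V V' : finType) (f g : V -> V') q
    (c : tuple_fun F V q) :
  f =1 g -> push f c = push g c.
Proof.
move=> fg; apply/ffunP=> y; rewrite !ffunE; apply: eq_bigl => x.
by congr (_ == _); apply: eq_from_tnth => i; rewrite !tnth_map.
Qed.

Section SimplicialMaps.
Variables (F : fieldType) (V V' : finType).
Variables (K : simplicial_complex V) (L : simplicial_complex V').
Implicit Types f g : V -> V'.

Definition simplicial f := forall s : {set V}, s \in K -> f @: s \in L.

Definition contiguous f g :=
  forall s : {set V}, s \in K -> f @: s :|: g @: s \in L.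

(** The image of [s] under [h] is a nonempty face of the simplex [f @: s :|: g @: s]. *)
Lemma contiguous_simplicial f g h : contiguous f g ->
  (forall v, h v = f v \/ h v = g v) -> simplicial h.
Proof.
move=> fg hfg s sK; apply: (simplex_face (fg s sK)).
  apply/subsetP=> _ /imsetP[v vs ->]; rewrite inE; apply/orP.
  by case: (hfg v) => ->; [left|right]; apply: imset_f.
apply: contraTneq sK => /eqP; rewrite imset_eq0 => /eqP ->.
exact: simplex_neq0.
Qed.

Lemma push_chains f q (c : tuple_fun F V q) : simplicial f ->
  c \in chains F K q -> push f c \in chains F L q.
Proof.
move=> fKL cK; have /chainsP[c0 cs] := cK.
apply/chainsP; split=> [y|s y]; last exact: push_permute.
rewrite negb_and => /orP[|yL]; first exact: push_not_uniq cK.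
rewrite ffunE big1 // => x /eqP xy; apply: c0; apply: contra yL => /andP[_ xK].
by rewrite -xy set_map_tuple fKL.
Qed.

Lemma push_cycles f q (c : tuple_fun F V q) : simplicial f ->
  c \in cycles F K q -> push f c \in cycles F L q.
Proof.
move=> fKL; case: q c => [|q] c; first exact: push_chains.
move=> /memv_capP[cK]; rewrite memv_ker => /eqP c0.
apply/memv_capP; split; first exact: push_chains.
by rewrite memv_ker push_boundary c0 linear0.
Qed.

Lemma push_boundaries f q (c : tuple_fun F V q) : simplicial f ->
  c \in boundaries F K q -> push f c \in boundaries F L q.
Proof.
move=> fKL /memv_imgP[d dK ->]; rewrite -push_boundary.
by apply: memv_img; apply: push_chains.
Qed.

(* A nonzero difference is carried by simplices containing v, so its cone with
   apex f v stays in L. *)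
Lemma push_contiguous1 f g v q (c : tuple_fun F V q) :
  contiguous f g -> (forall u, u != v -> g u = f u) ->
  c \in cycles F K q -> push g c - push f c \in boundaries F L q.
Proof.
move=> fg gf cZ; have cK : c \in chains F K q.
  by move: (cZ); case: (q) (c) => // ? ?; rewrite memv_cap => /andP[].
have [fKL gKL] : simplicial f /\ simplicial g.
  by split; apply: (contiguous_simplicial fg) => u; [left|right].
rewrite -[X in X \in _](@boundary_cone _ _ (f v)) => [|w]; last first.
  under eq_bigr do rewrite !ffunE.
  rewrite sumrB; apply/eqP; rewrite subr_eq0; apply/eqP.
  have := sum_push g c w; have := sum_push f c w.
  under eq_bigr do rewrite ffunE.
  move=> ->.
  under eq_bigr do rewrite ffunE.
  move=> ->.
  (* In degree 0 both pushforwards have the coefficient sum of [c]; in higher degrees both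
     boundaries vanish because [c] is a cycle. *)
  case: q c cZ cK w => [|q] c cZ cK w.
    by apply: eq_bigl => x; rewrite [map_tuple g x]tuple0 [map_tuple f x]tuple0.
  move: cZ; rewrite memv_cap memv_ker => /andP[_ /eqP]; rewrite lfunE /= => /ffunP c0.
  by rewrite !big1 // => x _; have := c0 x; rewrite !ffunE.
apply: memv_img; apply: cone_chains => [|y yL].
  by apply: rpredB; apply: push_chains.
have /chainsP[c0 _] := cK.
apply: contraNT => yn; rewrite !ffunE.
(* Tuples avoiding [v] have the same image under [f] and [g], so their contributions cancel. *)
rewrite (bigID (fun x : q.+1.-tuple V => v \in x)) /=.
rewrite [X in _ - X](bigID (fun x : q.+1.-tuple V => v \in x)) /=.
rewrite opprD addrACA [X in _ + X](_ : _ = 0) ?addr0; last first.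
  apply/eqP; rewrite subr_eq0; apply/eqP/eq_bigl => x.
  have [|vx] := boolP (v \in x); rewrite ?andbF // !andbT; congr (_ == _).
  apply: eq_from_tnth => i; rewrite !tnth_map; apply: gf.
  by apply: contraNneq vx => <-; exact: mem_tnth.
(* If such an [x] were a simplex of [K], then [f v] together with [y] would be a face of the union
   of its two images, contradicting [yn]. *)
have x0 h x : h = f \/ h = g -> map_tuple h x == y -> v \in x -> c x = 0.
  move=> hfg /eqP xy vx; apply: c0; apply: contra yn => /andP[_ xK].
  apply: (simplex_face (fg _ xK)); last by apply/set0Pn; exists (f v); rewrite !inE eqxx.
  have vX : v \in [set u in x] by rewrite inE.
  rewrite subUset sub1set inE imset_f //= -xy set_map_tuple.
  by case: hfg => ->; rewrite ?subsetUl ?subsetUr.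
rewrite !big1 ?subrr // => x /andP[xy vx].
  by apply: (x0 f) => //; left.
by apply: (x0 g) => //; right.
Qed.

Lemma push_contiguous f g q (c : tuple_fun F V q) :
  contiguous f g ->
  c \in cycles F K q -> push g c - push f c \in boundaries F L q.
Proof.
move=> fg cZ; pose h (s : seq V) v := if v \in s then g v else f v.
have hfg s v : h s v = f v \/ h s v = g v by rewrite /h; case: ifP; [right|left].
(* Every [h s] maps a simplex [x] into [f @: x :|: g @: x], so any two of these maps are
   contiguous. *)
have h_contiguous s t : contiguous (h s) (h t).
  move=> x xK; apply: (simplex_face (fg x xK)).
    apply/subsetP=> w; rewrite !inE.
    by case/orP=> /imsetP[v vx ->]; [case: (hfg s v)|case: (hfg t v)] => ->;
      rewrite imset_f ?orbT.
  have [x0|[v vx]] := set_0Vmem x; first by move: xK; rewrite x0 (negPf (simplex_neq0 K)).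
  by apply/set0Pn; exists (h s v); rewrite inE imset_f.
have -> : push g c = push (h (enum V)) c.
  by apply: eq_push => v; rewrite /h mem_enum.
have -> : push f c = push (h [::]) c by apply: eq_push.
elim: (enum V) => [|v s IHs]; first by rewrite subrr mem0v.
rewrite -(subrK (push (h s) c) (push (h (v :: s)) c)) -addrA; apply: rpredD => //.
apply: (@push_contiguous1 _ _ v) => // u uv.
by rewrite /h inE (negPf uv).
Qed.

End SimplicialMaps.

(** * Induced maps in homology and interleavings *)

Lemma push_id (F : fieldType) (V : finType) q (c : tuple_fun F V q) :
  push id c = c.
Proof.
apply/ffunP=> y; rewrite ffunE (big_pred1 y) // => x.
by congr (_ == _); apply: eq_from_tnth => i; rewrite tnth_map.
Qed.

Lemma push_comp (F : fieldType) (V V' V'' : finType) (g : V' -> V'')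
    (f : V -> V') q (c : tuple_fun F V q) :
  push g (push f c) = push (g \o f) c.
Proof.
apply/ffunP=> z; rewrite !ffunE; under eq_bigr do rewrite ffunE.
have gf x : map_tuple (g \o f) x = map_tuple g (map_tuple f x) :> q.+1.-tuple V''.
  by apply: eq_from_tnth => i; rewrite !tnth_map.
rewrite [RHS](partition_big (map_tuple f) (fun y => map_tuple g y == z)); last first.
  by move=> x; rewrite gf.
apply: eq_bigr => y /eqP yz; apply: eq_bigl => x; rewrite gf.
by have [->|] := eqVneq (map_tuple f x) y; rewrite ?andbF // yz eqxx.
Qed.

Section HomologyMap.
Variables (F : fieldType) (V V' : finType).
Variables (K : simplicial_complex V) (L : simplicial_complex V').
Variables (f : V -> V') (fKL : simplicial K L f) (q : nat).

Definition homology_map_fun (x : homology F K q) : homology F L q :=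
  vquot_pi _ (vsproj (cycles F L q) (push f (vsval (vquot_repr x)))).

(** Independence of the representative: two choices differ by a boundary, which [push] sends to a
    boundary. *)
Lemma homology_map_funE u : homology_map_fun (vquot_pi _ u) =
  vquot_pi _ (vsproj (cycles F L q) (push f (vsval u))).
Proof.
have pZ (w : subvs_of (cycles F K q)) : push f (vsval w) \in cycles F L q.
  exact: push_cycles fKL (subvsP w).
apply/vquot_eq; rewrite !vsprojK // -linearB.
by apply: (push_boundaries fKL); apply/vquot_eq; rewrite vquot_reprK.
Qed.

Lemma homology_map_is_linear : linear homology_map_fun.
Proof.
move=> a x y; rewrite -[x]vquot_reprK -[y]vquot_reprK -linearP.
by rewrite !homology_map_funE -linearP; congr vquot_pi; rewrite !linearP.
Qed.

HB.instance Definition _ :=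
  GRing.isLinear.Build F (homology F K q) (homology F L q) *:%R homology_map_fun
    homology_map_is_linear.

Definition homology_map : {linear homology F K q -> homology F L q} :=
  homology_map_fun.

Lemma homology_mapE u : homology_map (vquot_pi _ u) =
  vquot_pi _ (vsproj (cycles F L q) (push f (vsval u))).
Proof. exact: homology_map_funE. Qed.

End HomologyMap.

Section Naturality.
Variables (F : fieldType) (V V' : finType) (q : nat).

Lemma homology_map_incl (K K' : simplicial_complex V)
    (L L' : simplicial_complex V') (f : V -> V') (sK : K \subset K')
    (sL : L \subset L') (fKL : simplicial K L f) (fKL' : simplicial K' L' f) x :
  homology_map F fKL' q (homology_incl F sK q x) =
  homology_incl F sL q (homology_map F fKL q x).
Proof.
rewrite -[x]vquot_reprK; set u := vquot_repr x.
rewrite homology_mapE !vquot_mapE homology_mapE.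
rewrite !vsprojK //; first exact: push_cycles fKL (subvsP u).
exact: subvP (cycles_sub F sK q) _ (subvsP u).
Qed.

Lemma homology_map_contiguous (K M : simplicial_complex V)
    (L : simplicial_complex V') (f : V -> V') (g : V' -> V) (sKM : K \subset M)
    (fKL : simplicial K L f) (gLM : simplicial L M g) x :
  contiguous K M id (g \o f) ->
  homology_map F gLM q (homology_map F fKL q x) = homology_incl F sKM q x.
Proof.
move=> gf; rewrite -[x]vquot_reprK; set u := vquot_repr x.
have fu : push f (vsval u) \in cycles F L q by apply: push_cycles fKL (subvsP u).
rewrite vquot_mapE !homology_mapE; apply/vquot_eq.
rewrite !vsprojK //; last 2 first.
- by rewrite (subvP (cycles_sub F sKM q)) ?subvsP.
- exact: push_cycles gLM fu.
(* The inclusion leaves the cycle unchanged, so it is the pushforward along [id], to which [g \o f]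
   is contiguous. *)
rewrite push_comp -[X in _ - X]push_id.
exact: push_contiguous gf (subvsP u).
Qed.

End Naturality.

(** The same vertex maps serve all parameters, so the maps commute with the structure maps by
    naturality; contiguity supplies the two composition identities. *)
Lemma interleaved_contiguous (F : fieldType) (R : realType) (V V' : finType)
    (K : filtration R V) (L : filtration R V') (alpha beta : {nonneg R} -> {nonneg R})
    (f : V -> V') (g : V' -> V) q :
  {homo alpha : s t / s <= t} -> {homo beta : s t / s <= t} ->
  (forall s, s <= beta (alpha s)) -> (forall t, t <= alpha (beta t)) ->
  (forall s, simplicial (K s) (L (alpha s)) f) ->
  (forall t, simplicial (L t) (K (beta t)) g) ->
  (forall s, contiguous (K s) (K (beta (alpha s))) id (g \o f)) ->
  (forall t, contiguous (L t) (L (alpha (beta t))) id (f \o g)) ->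
  interleaved (persistent_homology F K q) (persistent_homology F L q) alpha beta.
Proof.
move=> ma mb ba ab fKL gLK gf fg.
exists ma, mb, ba, ab, (fun s => homology_map F (fKL s) q),
  (fun t => homology_map F (gLK t) q); split.
- by move=> s t st x; apply: homology_map_incl.
- by move=> s t st y; apply: homology_map_incl.
- by move=> s x; apply: homology_map_contiguous.
- by move=> t y; apply: homology_map_contiguous.
Qed.

(** * Hausdorff distance of finite sets *)

Section Hausdorff.
Local Open Scope classical_set_scope.
Variables (R : realType) (T : metricType R).

Lemma hausdorff_distC (A B : set T) : hausdorff_dist A B = hausdorff_dist B A.
Proof.
rewrite /hausdorff_dist; congr (maxe _ _); rewrite maxC.
by congr (maxe (ereal_sup _) (ereal_sup _)); apply: eq_imagel => x _;
  congr ereal_inf; apply: eq_imagel => y _; rewrite metric_sym.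
Qed.

(** Finiteness of [B] yields a point within [e] itself, with no slack: if all distances from [x]
    exceed [e], so does their minimum. *)
Lemma hausdorff_dist_le (S S' : {fset T}) (A : {set S}) (B : {set S'}) (e : R) x :
  (hausdorff_dist (points A) (points B) <= e%:E)%E -> x \in A ->
  exists2 y, y \in B & mdist (fsval x) (fsval y) <= e.
Proof.
move=> dAB xA; apply/exists_inP; apply: contraLR dAB.
rewrite negb_exists_in => /forall_inP far; rewrite -ltNge.
(* The default [e + 1] keeps [m] above [e] when [B] is empty. *)
pose m := \big[Num.min/e + 1]_(y in B) mdist (fsval x) (fsval y).
have em : e < m.
  by apply: lt_bigmin => [|y /far]; rewrite ?ltrDl // -ltNge.
apply: (@lt_le_trans _ _ m%:E); first by rewrite lte_fin.
rewrite /hausdorff_dist !le_max; apply/orP; right; apply/orP; left.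
apply: (@le_trans _ _ (ereal_inf [set (mdist (fsval x) b)%:E | b in points B])).
  apply: le_ereal_inf_tmp => _ [_ [y /= yB <-] <-].
  by rewrite lee_fin; apply: bigmin_le_cond.
by apply: ereal_sup_ubound; exists (fsval x) => //; exists x.
Qed.
End Hausdorff.

(** * Maps between cover complexes *)

Section Cover.
Variables (R : realType) (T : metricType R) (U : finType) (W : {set {set U}}).
Implicit Types S : {fset T}.

(** A general [i] treats [inl] and [inr] at once. The condition [0 <= r] matches the default 0 of
    the maxima in [diam]. *)
Lemma rips_coverP S (i : S -> U) (r : R) (s : {set S}) : 0 <= r ->
  reflect [/\ s != set0,
              forall x y, x \in s -> y \in s -> mdist (fsval x) (fsval y) <= r
            & exists2 A, A \in W & forall x, x \in s -> i x \in A]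
    (s \in rips_cover [set [set x | i x \in A] | A : {set U} in W] r).
Proof.
move=> r0; rewrite !inE; apply: (iffP andP) => [[/andP[s0 /bigmax_leP[_ dr]]]|].
  case/exists_inP=> _ /imsetP[A AW ->] /subsetP sA; split=> //.
    by move=> x y xs ys; have /bigmax_leP[_] := dr x xs; apply.
  by exists A => // x /sA; rewrite inE.
case=> s0 dr [A AW sA]; split.
  rewrite s0; apply: bigmax_le => // x xs; apply: bigmax_le => // y.
  exact: dr.
apply/exists_inP; exists [set x | i x \in A]; first exact: imset_f.
by apply/subsetP=> x /sA; rewrite inE.
Qed.

Variables (S S' : {fset T}) (i : S -> U) (j : S' -> U) (e : R).

(** The second clause lets [phi] keep a simplex inside the cover member that carries it. *)
Definition close_carried (phi : S -> S') := forall x,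
  mdist (fsval x) (fsval (phi x)) <= e /\
  (forall A, A \in W -> i x \in A -> j (phi x) \in A).

Lemma close_carried_exists :
  cover W = setT ->
  (forall A, A \in nonempty_intersections W ->
     (hausdorff_dist (points [set x | i x \in A]) (points [set y | j y \in A])
        <= e%:E)%E) ->
  exists phi, close_carried phi.
Proof.
move=> Wcov Wd; apply: (@fin_all_exists _ _ (fun x y =>
  mdist (fsval x) (fsval y) <= e /\
  (forall A, A \in W -> i x \in A -> j y \in A))) => x.
pose I := [set B in W | i x \in B]; pose A := \bigcap_(B in I) B.
have xA : i x \in A by apply/bigcapP=> B; rewrite inE => /andP[].
have AW : A \in nonempty_intersections W.
  rewrite inE; apply/andP; split; first by apply/set0Pn; exists (i x).
  apply/existsP; exists I; rewrite eqxx andbT; apply/andP; split.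
    (* The family [I] is nonempty because [W] covers. *)
    have : i x \in cover W by rewrite Wcov inE.
    by case/bigcupP=> B BW xB; apply/set0Pn; exists B; rewrite inE BW.
  by apply/subsetP=> B; rewrite inE => /andP[].
have [|y] := hausdorff_dist_le (x := x) (Wd _ AW); first by rewrite inE.
rewrite inE => /bigcapP yA dxy; exists y; split=> // B BW xB.
by apply: yA; rewrite inE BW.
Qed.

(** Each endpoint of an edge moves by at most [e], so its length grows by at most [2 * e]. *)
Lemma close_carried_simplicial phi (r t : R) : 0 <= r -> 0 <= t ->
  close_carried phi -> r + 2 * e <= t ->
  simplicial (rips_cover [set [set x | i x \in A] | A : {set U} in W] r)
    (rips_cover [set [set x | j x \in A] | A : {set U} in W] t) phi.
Proof.
move=> r0 t0 phiP ret s /(rips_coverP _ _ r0)[s0 dr [A AW sA]].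
apply/rips_coverP => //; split.
- by rewrite imset_eq0.
- move=> _ _ /imsetP[x xs ->] /imsetP[y ys ->].
  have [[dx _] [dy _]] := (phiP x, phiP y).
  have dxy := dr x y xs ys.
  have := metric_triangle (fsval (phi x)) (fsval x) (fsval (phi y)).
  have := metric_triangle (fsval x) (fsval y) (fsval (phi y)).
  rewrite (metric_sym (fsval (phi x)) (fsval x)); lra.
- by exists A => // _ /imsetP[x xs ->]; apply: (phiP x).2 => //; apply: sA.
Qed.
End Cover.

Lemma close_carried_contiguous (R : realType) (T : metricType R) (U : finType)
    (W : {set {set U}}) (S S' : {fset T}) (i : S -> U) (j : S' -> U) (e : R)
    phi psi (r t : R) : 0 <= r -> 0 <= t -> 0 <= e ->
  close_carried W i j e phi -> close_carried W j i e psi -> r + 4 * e <= t ->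
  contiguous (rips_cover [set [set x | i x \in A] | A : {set U} in W] r)
    (rips_cover [set [set x | i x \in A] | A : {set U} in W] t) id (psi \o phi).
Proof.
move=> r0 t0 e0 phiP psiP ret s /(rips_coverP _ _ _ r0)[s0 dr [A AW sA]].
have dh x : mdist (fsval x) (fsval (psi (phi x))) <= 2 * e.
  have [[dx _] [dy _]] := (phiP x, psiP (phi x)).
  have := metric_triangle (fsval x) (fsval (phi x)) (fsval (psi (phi x))).
  lra.
rewrite imset_id; apply/rips_coverP => //; split.
- by case/set0Pn: s0 => x xs; apply/set0Pn; exists x; rewrite inE xs.
- move=> x y; rewrite !inE.
  (* Every vertex of the union is within [2 * e] of a vertex of [s], so two of them are at most
     [2 * e + r + 2 * e] apart. *)
  have near z : z \in s \/ z \in (psi \o phi) @: s -> exists2 x', x' \in s &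
      mdist (fsval x') (fsval z) <= 2 * e.
    case=> [zs|/imsetP[x' xs ->]]; last by exists x'.
    by exists z => //; rewrite mdistxx; lra.
  move=> /orP/near[x' xs dx] /orP/near[y' ys dy].
  have dxy := dr x' y' xs ys.
  have := metric_triangle (fsval x) (fsval x') (fsval y).
  have := metric_triangle (fsval x') (fsval y') (fsval y).
  rewrite (metric_sym (fsval x) (fsval x')); lra.
- exists A => // x; rewrite inE => /orP[/sA //|/imsetP[x' xs ->]] /=.
  by apply: (psiP (phi x')).2 => //; apply: (phiP x').2 => //; apply: sA.
Qed.

Theorem corollary3p5 (F : fieldType) (R : realType) (T : metricType R)
    (X Y : {fset T}) (eps : {nonneg R}) (W : {set {set (X + Y)%type}})
    (W_cover : cover W = [set: (X + Y)%type]%SET)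
    (W_hausdorff : forall A, A \in nonempty_intersections W ->
      (hausdorff_dist (points (restrict_l A)) (points (restrict_r A))
         <= eps%:num%:E)%E)
    (q : nat) :
  let alpha (r : {nonneg R}) : {nonneg R} := (r%:num + 2 * eps%:num)%:nng in
  interleaved
    (persistent_homology F (rips_cover_filtration [set restrict_l A | A in W]%SET) q)
    (persistent_homology F (rips_cover_filtration [set restrict_r A | A in W]%SET) q)
    alpha alpha.
Proof.
move=> alpha.
have alphaE (r : {nonneg R}) : (alpha r)%:num = r%:num + 2 * eps%:num by [].
have e0 : 0 <= eps%:num by [].
have [phi phiP] := close_carried_exists W_cover W_hausdorff.
(* The map back comes from exchanging the samples, by symmetry of the Hausdorff distance. *)
have [|psi psiP] := close_carried_exists (i := inr) (j := inl) (e := eps%:num) W_cover.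
  by move=> A /W_hausdorff; rewrite hausdorff_distC.
have alpha_mono : {homo alpha : s t / s <= t}.
  by move=> s t st; rewrite -num_le !alphaE lerD2r.
have le_alpha2 s : s <= alpha (alpha s) by rewrite -num_le !alphaE; lra.
have alpha2E (r : {nonneg R}) : r%:num + 4 * eps%:num <= (alpha (alpha r))%:num.
  by rewrite !alphaE; lra.
apply: (@interleaved_contiguous _ _ _ _ _ _ _ _ phi psi) => // r.
- exact: close_carried_simplicial phiP _.
- exact: close_carried_simplicial psiP _.
- exact: close_carried_contiguous phiP psiP _.
- exact: close_carried_contiguous psiP phiP _.
Qed.
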